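(* Let $m_1,m_2,m_3>0$ and let $t\mapsto (z_1(t),z_2(t),z_3(t))$, $t\in[0,+\infty)$, be a collision-free solution of the Newtonian planar three-body problem with masses $m_1,m_2,m_3$ and center of mass at the origin. Suppose that the solution has zero angular momentum and negative energy. Then it has an infinite number of velocity syzygies, i.e. there are infinitely many $t\in[0,+\infty)$ such that the complex triplet $(\dot z_1(t),\dot z_2(t),\dot z_3(t))$ is collinear.
   Context: The Newtonian planar three-body problem with masses $m_1,m_2,m_3>0$ is the system for $z_k=x_k+iy_k\in\mathbb{C}$, $k=1,2,3$, $$\ddot z_1 = m_2\frac{z_{21}}{|z_{21}|^3}-m_3\frac{z_{13}}{|z_{13}|^3},\quad \ddot z_2 = m_3\frac{z_{32}}{|z_{32}|^3}-m_1\frac{z_{21}}{|z_{21}|^3},\quad \ddot z_3 = m_1\frac{z_{13}}{|z_{13}|^3}-m_2\frac{z_{32}}{|z_{32}|^3},$$ where $z_{kl}=z_k-z_l$. A solution is collision-free on an interval if $z_k(t)\neq z_l(t)$ for all $k\ne l$ and all $t$ in the interval. It is assumed throughout that $\sum_k m_k z_k=0$ and $\sum_k m_k\dot z_k=0$ (center of mass at the origin). The angular momentum is the conserved quantity $\sum_k m_k\,(x_k\dot y_k-y_k\dot x_k)$, and the energy is the conserved quantity $\frac12\sum_k m_k|\dot z_k|^2-\sum_{k<l}\frac{m_km_l}{|z_{kl}|}$. A triplet of complex numbers is collinear if the three corresponding points of the plane lie on a common real line. The bodies form a velocity syzygy at time $t_0$ if $(\dot z_1,\dot z_2,\dot z_3)(t_0)$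 is collinear (equivalently, since $\sum_k m_k\dot z_k=0$, the three velocity vectors are parallel). *)

(* Defs.v *)
From Stdlib Require Import Reals List.
From Coquelicot Require Import Coquelicot.

Open Scope R_scope.

(* Derivative, relative to the half-line [0, +oo), of a planar curve: two-sided
   for t > 0 and one-sided from the right at t = 0.  Values of the curve at
   negative times play no role.  With the filter [locally t] in place of
   [within _ (locally t)] this is [is_derive f t l]. *)
Definition is_derive_half_line (f : R -> C) (t : R) (l : C) : Prop :=
  filterdiff (K := R_AbsRing) (U := R_NormedModule) (V := C_R_NormedModule)
    f (within (fun s : R => 0 <= s) (locally t))
    (fun h : R => scal (V := C_R_NormedModule) h l).

(* w / |w|^3 *)
Definition inv_square (w : C) : C := (w / RtoC (Cmod w ^ 3))%C.

(* [v1 v2 v3] are the velocities of [z1 z2 z3] on [0, +oo). *)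
Definition three_body_solution (m1 m2 m3 : R)
    (z1 z2 z3 v1 v2 v3 : R -> C) : Prop :=
  forall t : R, 0 <= t ->
    (is_derive_half_line z1 t (v1 t) /\
     is_derive_half_line z2 t (v2 t) /\
     is_derive_half_line z3 t (v3 t)) /\
    (is_derive_half_line v1 t
       (RtoC m2 * inv_square (z2 t - z1 t)
        - RtoC m3 * inv_square (z1 t - z3 t))%C /\
     is_derive_half_line v2 t
       (RtoC m3 * inv_square (z3 t - z2 t)
        - RtoC m1 * inv_square (z2 t - z1 t))%C /\
     is_derive_half_line v3 t
       (RtoC m1 * inv_square (z1 t - z3 t)
        - RtoC m2 * inv_square (z3 t - z2 t))%C).

Definition collision_free (z1 z2 z3 : R -> C) : Prop :=
  forall t : R, 0 <= t -> z1 t <> z2 t /\ z2 t <> z3 t /\ z1 t <> z3 t.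

Definition center_of_mass_at_origin (m1 m2 m3 : R)
    (z1 z2 z3 v1 v2 v3 : R -> C) : Prop :=
  forall t : R, 0 <= t ->
    (RtoC m1 * z1 t + RtoC m2 * z2 t + RtoC m3 * z3 t = RtoC 0)%C /\
    (RtoC m1 * v1 t + RtoC m2 * v2 t + RtoC m3 * v3 t = RtoC 0)%C.

Definition angular_momentum (m1 m2 m3 : R) (z1 z2 z3 v1 v2 v3 : C) : R :=
  m1 * (Re z1 * Im v1 - Im z1 * Re v1)
  + m2 * (Re z2 * Im v2 - Im z2 * Re v2)
  + m3 * (Re z3 * Im v3 - Im z3 * Re v3).

Definition energy (m1 m2 m3 : R) (z1 z2 z3 v1 v2 v3 : C) : R :=
  / 2 * (m1 * Cmod v1 ^ 2 + m2 * Cmod v2 ^ 2 + m3 * Cmod v3 ^ 2)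
  - (m1 * m2 / Cmod (z1 - z2)%C
     + m1 * m3 / Cmod (z1 - z3)%C
     + m2 * m3 / Cmod (z2 - z3)%C).

Definition collinear (a b c : C) : Prop :=
  exists p d : C, d <> RtoC 0 /\
    exists r s u : R,
      a = (p + RtoC r * d)%C /\ b = (p + RtoC s * d)%C /\
      c = (p + RtoC u * d)%C.

Definition infinitely_many (P : R -> Prop) : Prop :=
  ~ exists l : list R, forall t : R, P t -> In t l.

(* Main.v *)
Require Import Defs.
From Stdlib Require Import Reals List Lra.
From Coquelicot Require Import Coquelicot.

(* In Jacobi coordinates, with the second one rescaled so that the kinetic
   metric is a multiple of the identity, let X be the 2x2 matrix with columns
   z2 - z1 and k z3, and V = X'.  Newton's equations read X'' = - X W with W
   symmetric and positive, negative energy keeps tr W above a positive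
   constant, and zero angular momentum says that X V^T is symmetric.  If the
   velocities are not collinear after time T, then V is invertible there and
   Y = V^-1 X is symmetric, with the Riccati equation Y' = I + Y W Y.  Hence
   Y' >= I and Y becomes positive definite.  From then on tr(Y^-1) > 0, while
   (tr Y^-1)' = - tr(Y^-2) - tr W is bounded above by a negative constant: a
   contradiction. *)

(** * Calculus on the half-line and mean value bounds *)

(** Passing to real coordinates with two-sided derivatives makes [auto_derive] and the mean value
    theorem available on the closed half-line, including the endpoint 0. *)
Lemma half_line_extension (f l : R -> C) :
  (forall t, 0 <= t -> is_derive_half_line f t (l t)) ->
  exists g h : R -> R, forall t, 0 <= t ->
    (g t = Re (f t) /\ is_derive g t (Re (l t))) /\
    (h t = Im (f t) /\ is_derive h t (Im (l t))).
Proof.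
intros Hf.
assert (glue : forall P : C -> R,
  (forall z z' : C, P (z - z')%C = P z - P z') ->
  (forall (k : R) (z : C), P (scal (V := C_R_NormedModule) k z) = k * P z) ->
  (forall z : C, Rabs (P z) <= norm (V := C_R_NormedModule) z) ->
  exists g : R -> R, forall t, 0 <= t ->
    g t = P (f t) /\ is_derive g t (P (l t))).
{ intros P Pminus Pscal Pbound.
  (* Gluing the tangent at 0 turns the one-sided derivative there into a two-sided one. *)
  set (g t := if Rle_dec 0 t then P (f t) else P (f 0) + t * P (l 0)).
  exists g; intros t Ht.
  assert (gE : forall s, 0 <= s -> g s = P (f s)).
  { intros s Hs; unfold g; destruct (Rle_dec 0 s); [reflexivity | lra]. }
  split; [now apply gE |].
  split; [apply is_linear_scal_l |].
  intros x Hx.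
  rewrite <- (is_filter_lim_locally_unique _ _ Hx).
  intros eps.
  destruct (Hf t Ht) as [_ Hd].
  assert (Hlim : is_filter_lim (within (fun s : R => 0 <= s) (locally t)) t).
  { intros Q HQ; unfold within; revert HQ; apply filter_imp; auto. }
  destruct (Hd t Hlim eps) as [d Hdd].
  (* For t > 0 the radius is capped at t, which keeps y positive; the linear branch of [g] is then
     met only when t = 0. *)
  assert (Hd' : 0 < (if Rlt_dec 0 t then Rmin d t else d)).
  { destruct (Rlt_dec 0 t); [apply Rmin_pos; [apply d | lra] | apply d]. }
  exists (mkposreal _ Hd'); intros y Hy.
  assert (By : Rabs (y - t) < if Rlt_dec 0 t then Rmin d t else d) by exact Hy.
  clear Hy.
  change (Rabs ((g y - g t) - (y - t) * P (l t)) <= eps * Rabs (y - t)).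
  destruct (Rle_dec 0 y) as [Hy | Hy].
  - assert (Byd : ball t d y).
    { change (Rabs (y - t) < d).
      destruct (Rlt_dec 0 t); [| exact By].
      apply Rlt_le_trans with (1 := By), Rmin_l. }
    specialize (Hdd y Byd Hy).
    rewrite !gE by assumption.
    rewrite <- Pminus.
    rewrite <- Pscal.
    rewrite <- Pminus.
    eapply Rle_trans; [apply Pbound |].
    exact Hdd.
  - assert (t = 0).
    { destruct (Rlt_dec 0 t); [| lra].
      assert (Rabs (y - t) < t) by (eapply Rlt_le_trans; [exact By | apply Rmin_r]).
      apply Rabs_def2 in H; lra. }
    subst t. unfold g at 1; destruct (Rle_dec 0 y); [lra |].
    rewrite gE by lra.
    replace (P (f 0) + y * P (l 0) - P (f 0) - (y - 0) * P (l 0)) with 0 by ring.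
    rewrite Rabs_R0. apply Rmult_le_pos; [apply Rlt_le, eps | apply Rabs_pos]. }
destruct (glue Re) as [g Hg].
- intros [a b] [a' b']; reflexivity.
- intros k [a b]; reflexivity.
- intros [a b]. eapply Rle_trans; [apply Rmax_l | apply (norm_prod (K := R_AbsRing) (U := R_NormedModule) (V := R_NormedModule) a b)].
- destruct (glue Im) as [h Hh].
  + intros [a b] [a' b']; reflexivity.
  + intros k [a b]; reflexivity.
  + intros [a b]. eapply Rle_trans; [apply Rmax_r | apply (norm_prod (K := R_AbsRing) (U := R_NormedModule) (V := R_NormedModule) a b)].
  + exists g, h; intros t Ht; split; auto.
Qed.

Lemma derive_ge_growth (f df : R -> R) (k s t : R) :
  s <= t ->
  (forall u, s <= u <= t -> is_derive f u (df u) /\ k <= df u) ->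
  f s + k * (t - s) <= f t.
Proof.
intros Hst Hf.
destruct (MVT_gen f s t df) as [c [Hc Heq]].
- intros u Hu; rewrite Rmin_left, Rmax_right in Hu by lra; apply Hf; lra.
- intros u Hu; rewrite Rmin_left, Rmax_right in Hu by lra.
  apply derivable_continuous_pt; exists (df u); apply is_derive_Reals, Hf; lra.
- rewrite Rmin_left, Rmax_right in Hc by lra.
  assert (k * (t - s) <= df c * (t - s)) by (apply Rmult_le_compat_r; [lra | apply Hf, Hc]).
  lra.
Qed.

Lemma derive_zero_constant (f : R -> R) (t : R) :
  0 <= t -> (forall u, 0 <= u -> is_derive f u 0) -> f t = f 0.
Proof.
intros Ht Hf.
assert (f 0 + 0 * (t - 0) <= f t).
{ apply derive_ge_growth with (df := fun _ => 0); [lra |].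
  intros u Hu; split; [apply Hf; lra | lra]. }
assert (- f 0 + 0 * (t - 0) <= - f t).
{ apply (derive_ge_growth (fun u => - f u) (fun _ => 0)); [lra |].
  intros u Hu; split; [| lra].
  replace 0 with (opp 0) by apply Ropp_0. apply @is_derive_opp, Hf; lra. }
lra.
Qed.

(** [auto_derive] leaves [Derive] of eta-expanded abstract functions in its goal; the type
    ascription makes the rewriting match that form. *)
Ltac rewrite_derive :=
  repeat match goal with
  | H : is_derive ?f ?t ?l |- context [Derive (fun x : R => ?f x) ?t] =>
      rewrite (is_derive_unique f t l H : Derive (fun x : R => f x) t = l)
  end.

(** * The Riccati argument for X'' = - X W *)

Lemma sym2_form_nonneg (a b d u v : R) :
  0 <= a -> 0 <= d -> b * b <= a * d ->
  0 <= a * u ^ 2 + 2 * b * (u * v) + d * v ^ 2.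
Proof.
intros Ha Hd Hb.
destruct (Rle_lt_or_eq_dec 0 a Ha) as [Hp | <-].
- apply Rmult_le_reg_l with a; [lra |].
  replace (a * (a * u ^ 2 + 2 * b * (u * v) + d * v ^ 2))
    with ((a * u + b * v) ^ 2 + (a * d - b * b) * v ^ 2) by ring.
  rewrite Rmult_0_r.
  apply Rplus_le_le_0_compat; [apply pow2_ge_0 |].
  apply Rmult_le_pos; [lra | apply pow2_ge_0].
- assert (b = 0) by nra. subst b. pose proof (pow2_ge_0 v). nra.
Qed.

(** A crude lower bound for the least eigenvalue; applied to [Y] at time [T], it tells how long to
    wait until [Y] is positive definite. *)
Lemma sym2_form_bound (a b d u v : R) :
  - (Rabs a + Rabs b + Rabs d) * (u ^ 2 + v ^ 2)
    <= a * u ^ 2 + 2 * b * (u * v) + d * v ^ 2.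
Proof.
pose proof (Rabs_pos a); pose proof (Rabs_pos b); pose proof (Rabs_pos d).
pose proof (pow2_ge_0 u); pose proof (pow2_ge_0 v).
assert (- Rabs a * u ^ 2 <= a * u ^ 2).
{ apply Rmult_le_compat_r; [assumption |]. pose proof (Rle_abs (- a)) as K; rewrite Rabs_Ropp in K; lra. }
assert (- Rabs d * v ^ 2 <= d * v ^ 2).
{ apply Rmult_le_compat_r; [assumption |]. pose proof (Rle_abs (- d)) as K; rewrite Rabs_Ropp in K; lra. }
assert (- (Rabs b * (u ^ 2 + v ^ 2)) <= 2 * b * (u * v)).
{ pose proof (pow2_ge_0 (u + v)); pose proof (pow2_ge_0 (u - v)).
  unfold Rabs; destruct (Rcase_abs b); nra. }
nra.
Qed.

(** Here X has rows (x1, y1) and (x2, y2), V has rows (p1, q1) and (p2, q2), and W has entries [a],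
    [b], [b], [d]. The last hypothesis is the symmetry of X V^T, and the conclusion concerns det
    V. *)
Lemma linear_system_velocity_degenerate
    (x1 x2 y1 y2 p1 p2 q1 q2 a b d : R -> R) (c T : R) :
  0 < c ->
  (forall t, T <= t ->
    (is_derive x1 t (p1 t) /\ is_derive x2 t (p2 t) /\
     is_derive y1 t (q1 t) /\ is_derive y2 t (q2 t)) /\
    (is_derive p1 t (- (a t * x1 t + b t * y1 t)) /\
     is_derive p2 t (- (a t * x2 t + b t * y2 t)) /\
     is_derive q1 t (- (b t * x1 t + d t * y1 t)) /\
     is_derive q2 t (- (b t * x2 t + d t * y2 t))) /\
    (0 <= a t /\ 0 <= d t /\ b t * b t <= a t * d t /\ c <= a t + d t) /\
    x1 t * p2 t - x2 t * p1 t + (y1 t * q2 t - y2 t * q1 t) = 0) ->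
  ~ forall t, T <= t -> p1 t * q2 t - p2 t * q1 t <> 0.
Proof.
intros Hc Hsys Hdet.
set (Y11 t := (q2 t * x1 t - q1 t * x2 t) / (p1 t * q2 t - p2 t * q1 t)).
set (Y12 t := (q2 t * y1 t - q1 t * y2 t) / (p1 t * q2 t - p2 t * q1 t)).
set (Y21 t := (p1 t * x2 t - p2 t * x1 t) / (p1 t * q2 t - p2 t * q1 t)).
set (Y22 t := (p1 t * y2 t - p2 t * y1 t) / (p1 t * q2 t - p2 t * q1 t)).
assert (sym : forall t, T <= t -> Y21 t = Y12 t).
{ intros t Ht; unfold Y12, Y21; f_equal.
  destruct (Hsys t Ht) as (_ & _ & _ & J); lra. }
assert (growth : forall u v t, T <= t ->
  Y11 T * u ^ 2 + 2 * Y12 T * (u * v) + Y22 T * v ^ 2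
    + (u ^ 2 + v ^ 2) * (t - T)
  <= Y11 t * u ^ 2 + 2 * Y12 t * (u * v) + Y22 t * v ^ 2).
{ intros u v t Ht.
  (* With [Y12] and [Y21] kept apart, the derivative formula is a rational identity that [field]
     proves without using the symmetry. *)
  replace (2 * Y12 T) with (Y12 T + Y21 T) by (rewrite sym; lra).
  replace (2 * Y12 t) with (Y12 t + Y21 t) by (rewrite sym; lra).
  apply (derive_ge_growth
    (fun s => Y11 s * u ^ 2 + (Y12 s + Y21 s) * (u * v) + Y22 s * v ^ 2)
    (fun s => u ^ 2 + v ^ 2 +
      (a s * (Y11 s * u + Y21 s * v) * (Y11 s * u + Y12 s * v)
       + b s * ((Y11 s * u + Y21 s * v) * (Y21 s * u + Y22 s * v)
                + (Y12 s * u + Y22 s * v) * (Y11 s * u + Y12 s * v))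
       + d s * (Y12 s * u + Y22 s * v) * (Y21 s * u + Y22 s * v))));
    [assumption |].
  intros s Hs.
  assert (HT : T <= s) by lra.
  pose proof (Hdet s HT) as D0.
  destruct (Hsys s HT) as ((X1 & X2 & V1 & V2) & (P1 & P2 & Q1 & Q2) & (A0 & D0' & BB & _) & _).
  split.
  - unfold Y11, Y12, Y21, Y22. auto_derive.
    + repeat split; auto; eexists; eassumption.
    + rewrite_derive.
      field. assumption.
  (* Once [Y] is symmetric, the contribution of Y W Y is the form of W at the vector Y (u, v). *)
  - rewrite (sym s HT).
    pose proof (sym2_form_nonneg (a s) (b s) (d s)
      (Y11 s * u + Y12 s * v) (Y12 s * u + Y22 s * v) A0 D0' BB).
    lra. }
(* Y(T) >= - K I and Y' >= I, so Y >= I from time T + K + 1 on. *)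
set (K := Rabs (Y11 T) + Rabs (Y12 T) + Rabs (Y22 T)).
assert (K0 : 0 <= K).
{ unfold K. pose proof (Rabs_pos (Y11 T)); pose proof (Rabs_pos (Y12 T)); pose proof (Rabs_pos (Y22 T)); lra. }
assert (posdef : forall t, T + K + 1 <= t -> forall u v,
  u ^ 2 + v ^ 2 <= Y11 t * u ^ 2 + 2 * Y12 t * (u * v) + Y22 t * v ^ 2).
{ intros t Ht u v.
  pose proof (growth u v t ltac:(lra)).
  pose proof (sym2_form_bound (Y11 T) (Y12 T) (Y22 T) u v) as B. fold K in B.
  pose proof (pow2_ge_0 u); pose proof (pow2_ge_0 v). nra. }
(* [L] is tr(X^-1 V), the logarithmic derivative of det X. *)
set (L t := (p1 t * y2 t + x1 t * q2 t - p2 t * y1 t - x2 t * q1 t) / (x1 t * y2 t - x2 t * y1 t)).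
assert (Lpos : forall t, T + K + 1 <= t -> x1 t * y2 t - x2 t * y1 t <> 0 /\ 0 < L t).
{ intros t Ht.
  assert (HT : T <= t) by lra.
  pose proof (Hdet t HT) as D0.
  assert (H1 : 1 <= Y11 t) by (pose proof (posdef t Ht 1 0); lra).
  assert (H2 : 1 <= Y22 t) by (pose proof (posdef t Ht 0 1); lra).
  assert (H3 : 0 < Y11 t * Y22 t - Y12 t * Y21 t).
  (* At the vector (- Y12, Y11) the form of Y equals Y11 det Y. *)
  { rewrite (sym t HT). pose proof (posdef t Ht (- Y12 t) (Y11 t)). 
    pose proof (pow2_ge_0 (Y12 t)).
    apply Rmult_lt_reg_l with (Y11 t); [lra |]. nra. }
  assert (E : x1 t * y2 t - x2 t * y1 t =
    (Y11 t * Y22 t - Y12 t * Y21 t) * (p1 t * q2 t - p2 t * q1 t)).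
  { unfold Y11, Y12, Y21, Y22; field; assumption. }
  assert (X0 : x1 t * y2 t - x2 t * y1 t <> 0).
  { rewrite E; apply Rmult_integral_contrapositive; split; lra. }
  split; [assumption |].
  (* For 2x2 matrices, tr(Y^-1) = tr Y / det Y. *)
  replace (L t) with ((Y11 t + Y22 t) / (Y11 t * Y22 t - Y12 t * Y21 t)).
  - apply Rdiv_lt_0_compat; lra.
  - assert (E1 : p1 t * y2 t + x1 t * q2 t - p2 t * y1 t - x2 t * q1 t =
      (Y11 t + Y22 t) * (p1 t * q2 t - p2 t * q1 t)).
    { unfold Y11, Y22; field; assumption. }
    unfold L; rewrite E, E1; field; split; [assumption | lra]. }
assert (decay : forall t, T + K + 1 <= t ->
  - L (T + K + 1) + c * (t - (T + K + 1)) <= - L t).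
{ intros t Ht.
  (* The derivative is tr W + tr(Y^-2), written with tr(Y^-2) = (tr Y^-1)^2 - 2 det(Y^-1) and
     det(Y^-1) = det V / det X. *)
  apply (derive_ge_growth (fun s => - L s)
    (fun s => a s + d s + (L s) ^ 2
      - 2 * (p1 s * q2 s - p2 s * q1 s) / (x1 s * y2 s - x2 s * y1 s)));
    [assumption |].
  intros s Hs.
  assert (HT : T <= s) by lra.
  destruct (Lpos s ltac:(lra)) as [X0 _].
  destruct (Hsys s HT) as ((X1 & X2 & V1 & V2) & (P1 & P2 & Q1 & Q2) & (_ & _ & _ & tr) & J).
  split.
  - unfold L. auto_derive.
    + repeat split; auto; eexists; eassumption.
    + rewrite_derive.
      field. assumption.
  - set (n := p1 s * x2 s - p2 s * x1 s).
    assert (N : q2 s * y1 s - q1 s * y2 s = n) by (unfold n; lra).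
    set (D := x1 s * y2 s - x2 s * y1 s) in *.
    set (D1 := p1 s * y2 s + x1 s * q2 s - p2 s * y1 s - x2 s * q1 s).
    set (B := p1 s * q2 s - p2 s * q1 s).
    (* This is the discriminant of the characteristic polynomial of (det V) Y. The symmetry [N] of
       the off-diagonal entries makes it a sum of squares: the eigenvalues are real. *)
    assert (disc : D1 ^ 2 - 4 * D * B =
      (q2 s * x1 s - q1 s * x2 s - (p1 s * y2 s - p2 s * y1 s)) ^ 2 + 4 * n * n).
    { rewrite <- N at 1. unfold D1, D, B, n; ring. }
    assert (Z : 0 <= (L s) ^ 2 - 2 * B / D).
    { replace ((L s) ^ 2 - 2 * B / D) with ((D1 ^ 2 + (D1 ^ 2 - 4 * D * B)) / 2 * (/ D) ^ 2)
        by (unfold L; fold D D1; field; assumption).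
      apply Rmult_le_pos; [| apply pow2_ge_0].
      rewrite disc.
      pose proof (pow2_ge_0 D1); pose proof (pow2_ge_0 n).
      pose proof (pow2_ge_0 (q2 s * x1 s - q1 s * x2 s - (p1 s * y2 s - p2 s * y1 s))).
      nra. }
    fold B D. lra. }
pose proof (Lpos (T + K + 1) ltac:(lra)) as [_ L0].
assert (Hq : 0 <= L (T + K + 1) / c) by (apply Rlt_le, Rdiv_lt_0_compat; lra).
(* This is the time at which the linear bound forces [L] to be at most 0. *)
pose proof (decay (T + K + 1 + L (T + K + 1) / c) ltac:(lra)) as F.
pose proof (Lpos (T + K + 1 + L (T + K + 1) / c) ltac:(lra)) as [_ L1].
replace (c * (T + K + 1 + L (T + K + 1) / c - (T + K + 1))) with (L (T + K + 1)) in F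
  by (field; lra).
lra.
Qed.

(* Unlike [repeat split], does not unfold [is_derive], itself a conjunction. *)
Ltac split_and := repeat match goal with |- _ /\ _ => split end.

(** * Newton's equations in Jacobi coordinates *)

Lemma is_derive_inv_dist (x y : R -> R) (t p q : R) :
  is_derive x t p -> is_derive y t q -> 0 < x t ^ 2 + y t ^ 2 ->
  is_derive (fun s => / sqrt (x s ^ 2 + y s ^ 2)) t
    (- (x t * p + y t * q) / sqrt (x t ^ 2 + y t ^ 2) ^ 3).
Proof.
intros X Y H.
assert (S := sqrt_lt_R0 _ H).
auto_derive.
- split_and; try (eexists; eassumption); simpl in *; lra.
- rewrite_derive.
  replace (x t * (x t * 1) + y t * (y t * 1)) with (x t ^ 2 + y t ^ 2) by ring.
  field. lra.
Qed.

(** Converts a lower bound on the sum of inverse distances into one on the sum of their cubes, which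
    enters tr W. The constant is 3/16 - 6/64. *)
Lemma sum_cubes_lower_bound (u v w s : R) :
  0 <= u -> 0 <= v -> 0 <= w -> 0 < s -> s <= u + v + w ->
  3 / 32 * s ^ 3 <= u ^ 3 + v ^ 3 + w ^ 3.
Proof.
intros Hu Hv Hw Hs H.
(* The tangent line of the cube at s / 4 makes the bound linear. *)
assert (tangent : forall r, 0 <= r -> 3 * (s / 4) ^ 2 * r - 2 * (s / 4) ^ 3 <= r ^ 3).
{ intros r Hr.
  assert (0 <= (r - s / 4) ^ 2 * (r + 2 * (s / 4))).
  { apply Rmult_le_pos; [apply pow2_ge_0 | lra]. }
  nra. }
pose proof (tangent u Hu); pose proof (tangent v Hv); pose proof (tangent w Hw).
assert (0 <= (s / 4) ^ 2 * (u + v + w - s)).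
{ apply Rmult_le_pos; [apply pow2_ge_0 | lra]. }
nra.
Qed.

Lemma planar_three_body_velocity_degenerate
    (m1 m2 m3 : R) (x1 x2 x3 y1 y2 y3 u1 u2 u3 w1 w2 w3 : R -> R) (T : R) :
  let r21 t := sqrt ((x2 t - x1 t) ^ 2 + (y2 t - y1 t) ^ 2) in
  let r13 t := sqrt ((x1 t - x3 t) ^ 2 + (y1 t - y3 t) ^ 2) in
  let r32 t := sqrt ((x3 t - x2 t) ^ 2 + (y3 t - y2 t) ^ 2) in
  let J t := m1 * (x1 t * w1 t - y1 t * u1 t) + m2 * (x2 t * w2 t - y2 t * u2 t)
    + m3 * (x3 t * w3 t - y3 t * u3 t) in
  let E t := / 2 * (m1 * (u1 t ^ 2 + w1 t ^ 2) + m2 * (u2 t ^ 2 + w2 t ^ 2)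
      + m3 * (u3 t ^ 2 + w3 t ^ 2))
    - (m1 * m2 * / r21 t + m1 * m3 * / r13 t + m2 * m3 * / r32 t) in
  0 < m1 -> 0 < m2 -> 0 < m3 -> 0 <= T ->
  (forall t, 0 <= t ->
    (is_derive x1 t (u1 t) /\ is_derive x2 t (u2 t) /\ is_derive x3 t (u3 t) /\
     is_derive y1 t (w1 t) /\ is_derive y2 t (w2 t) /\ is_derive y3 t (w3 t)) /\
    (is_derive u1 t (m2 * ((x2 t - x1 t) / r21 t ^ 3) - m3 * ((x1 t - x3 t) / r13 t ^ 3)) /\
     is_derive u2 t (m3 * ((x3 t - x2 t) / r32 t ^ 3) - m1 * ((x2 t - x1 t) / r21 t ^ 3)) /\
     is_derive u3 t (m1 * ((x1 t - x3 t) / r13 t ^ 3) - m2 * ((x3 t - x2 t) / r32 t ^ 3)) /\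
     is_derive w1 t (m2 * ((y2 t - y1 t) / r21 t ^ 3) - m3 * ((y1 t - y3 t) / r13 t ^ 3)) /\
     is_derive w2 t (m3 * ((y3 t - y2 t) / r32 t ^ 3) - m1 * ((y2 t - y1 t) / r21 t ^ 3)) /\
     is_derive w3 t (m1 * ((y1 t - y3 t) / r13 t ^ 3) - m2 * ((y3 t - y2 t) / r32 t ^ 3))) /\
    (0 < r21 t /\ 0 < r13 t /\ 0 < r32 t) /\
    (m1 * x1 t + m2 * x2 t + m3 * x3 t = 0 /\ m1 * y1 t + m2 * y2 t + m3 * y3 t = 0 /\
     m1 * u1 t + m2 * u2 t + m3 * u3 t = 0 /\ m1 * w1 t + m2 * w2 t + m3 * w3 t = 0)) ->
  J 0 = 0 -> E 0 < 0 ->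
  ~ forall t, T <= t -> (u2 t - u1 t) * w3 t - (w2 t - w1 t) * u3 t <> 0.
Proof.
intros r21 r13 r32 J E M1 M2 M3 HT Hsol J0 E0 Hdet.
assert (JC : forall t, 0 <= t -> J t = 0).
{ intros t Ht; rewrite <- J0; apply derive_zero_constant; [assumption |].
  clear t Ht; intros t Ht.
  destruct (Hsol t Ht) as ((X1 & X2 & X3 & Y1 & Y2 & Y3) & (U1 & U2 & U3 & W1 & W2 & W3) & _).
  unfold J; auto_derive.
  - split_and; eexists; eassumption.
  - rewrite_derive. unfold Rdiv. ring. }
assert (EC : forall t, 0 <= t -> E t = E 0).
{ intros t Ht; apply derive_zero_constant; [assumption |].
  clear t Ht; intros t Ht.
  destruct (Hsol t Ht) as ((X1 & X2 & X3 & Y1 & Y2 & Y3) & (U1 & U2 & U3 & W1 & W2 & W3) & (R1 & R2 & R3) & _).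
  assert (dist : forall p q p' q' : R -> R, forall a b a' b' : R,
    is_derive p t a -> is_derive q t b -> is_derive p' t a' -> is_derive q' t b' ->
    0 < sqrt ((p t - p' t) ^ 2 + (q t - q' t) ^ 2) ->
    is_derive (fun s => / sqrt ((p s - p' s) ^ 2 + (q s - q' s) ^ 2)) t
      (- ((p t - p' t) * (a - a') + (q t - q' t) * (b - b'))
        / sqrt ((p t - p' t) ^ 2 + (q t - q' t) ^ 2) ^ 3)).
  { intros p q p' q' a b a' b' Dp Dq Dp' Dq' Hpos.
    apply (is_derive_inv_dist (fun s => p s - p' s) (fun s => q s - q' s)).
    - exact (is_derive_minus _ _ _ _ _ Dp Dp').
    - exact (is_derive_minus _ _ _ _ _ Dq Dq').
    - apply sqrt_lt_0_alt; rewrite sqrt_0; exact Hpos. }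
  pose proof (dist x2 y2 x1 y1 _ _ _ _ X2 Y2 X1 Y1 R1) as D21.
  pose proof (dist x1 y1 x3 y3 _ _ _ _ X1 Y1 X3 Y3 R2) as D13.
  pose proof (dist x3 y3 x2 y2 _ _ _ _ X3 Y3 X2 Y2 R3) as D32.
  clear dist.
  fold (r21 t) in D21; fold (r13 t) in D13; fold (r32 t) in D32.
  (* The inverse distances become opaque functions with known derivatives, so that [auto_derive]
     does not open the square roots. *)
  set (i21 s := / r21 s); set (i13 s := / r13 s); set (i32 s := / r32 s).
  change (is_derive i21 t (- ((x2 t - x1 t) * (u2 t - u1 t) + (y2 t - y1 t) * (w2 t - w1 t)) / r21 t ^ 3)) in D21.
  change (is_derive i13 t (- ((x1 t - x3 t) * (u1 t - u3 t) + (y1 t - y3 t) * (w1 t - w3 t)) / r13 t ^ 3)) in D13.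
  change (is_derive i32 t (- ((x3 t - x2 t) * (u3 t - u2 t) + (y3 t - y2 t) * (w3 t - w2 t)) / r32 t ^ 3)) in D32.
  change (is_derive (fun t => / 2 * (m1 * (u1 t ^ 2 + w1 t ^ 2) + m2 * (u2 t ^ 2 + w2 t ^ 2)
      + m3 * (u3 t ^ 2 + w3 t ^ 2))
    - (m1 * m2 * i21 t + m1 * m3 * i13 t + m2 * m3 * i32 t)) t 0).
  clearbody i21 i13 i32.
  auto_derive.
  - split_and; eexists; eassumption.
  - rewrite_derive. field. split_and; lra. }
set (mu := m3 * (m1 + m2 + m3) / (m1 * m2)).
assert (Hmu : 0 < mu).
{ apply Rdiv_lt_0_compat; apply Rmult_lt_0_compat; lra. }
(* [mu] is the ratio of the two reduced masses of the Jacobi coordinates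
   [z2 - z1] and [z3]. *)
set (k := sqrt mu).
assert (Hk : 0 < k) by (apply sqrt_lt_R0, Hmu).
assert (Hkk : k * k = mu) by (apply sqrt_sqrt; lra).
set (s21 t := / r21 t ^ 3); set (s13 t := / r13 t ^ 3); set (s32 t := / r32 t ^ 3).
(* The vector from the center of mass of bodies 1 and 2 to body 3 is [al] times z3. *)
set (al := (m1 + m2 + m3) / (m1 + m2)).
(* The potential sum is at least - E, and at most the sum of the mass products times the sum of
   inverse distances; the latter sum is thus at least [sigma]. *)
set (sigma := - E 0 / (m1 * m2 + m1 * m3 + m2 * m3)).
assert (m1 * m2 > 0 /\ m1 * m3 > 0 /\ m2 * m3 > 0) as (M12 & M13 & M23).
{ split_and; apply Rmult_lt_0_compat; assumption. }
assert (Hsigma : 0 < sigma) by (apply Rdiv_lt_0_compat; lra).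
assert (Hmin : 0 < Rmin m1 m2) by (apply Rmin_pos; assumption).
(* The entries of W come from writing z3 - z2 and z1 - z3 in terms of z3 and z2 - z1. The constant
   [c] is valid because tr W is at least [Rmin m1 m2] times the sum of the inverse cubed
   distances. *)
apply (linear_system_velocity_degenerate
  (fun t => x2 t - x1 t) (fun t => y2 t - y1 t) (fun t => k * x3 t) (fun t => k * y3 t)
  (fun t => u2 t - u1 t) (fun t => w2 t - w1 t) (fun t => k * u3 t) (fun t => k * w3 t)
  (fun t => (m1 + m2) * s21 t + m3 * (m1 / (m1 + m2) * s32 t + m2 / (m1 + m2) * s13 t))
  (fun t => m3 * al * (s13 t - s32 t) / k)
  (fun t => al * (m1 * s13 t + m2 * s32 t))
  (Rmin m1 m2 * (3 / 32 * sigma ^ 3)) T).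
- apply Rmult_lt_0_compat; [assumption |]. pose proof (pow_lt sigma 3 Hsigma). lra.
- intros t Ht.
  destruct (Hsol t ltac:(lra)) as ((X1 & X2 & X3 & Y1 & Y2 & Y3) & (U1 & U2 & U3 & W1 & W2 & W3)
    & (R1 & R2 & R3) & (CX & CY & CU & CW)).
  assert (jacobi : forall p1 p2 p3, m1 * p1 + m2 * p2 + m3 * p3 = 0 ->
    p3 - p2 = al * p3 - m1 / (m1 + m2) * (p2 - p1) /\
    p1 - p3 = - al * p3 - m2 / (m1 + m2) * (p2 - p1)).
  { intros p1 p2 p3 Hp. replace p3 with (- (m1 * p1 + m2 * p2) / m3).
    - unfold al; split; field; lra.
    - apply Rmult_eq_reg_l with m3; [| lra]. field_simplify; lra. }
  assert (mub : m3 * al * k / k = m3 * al) by (field; lra).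
  assert (al0 : 1 <= al).
  { unfold al. apply Rmult_le_reg_r with (m1 + m2); [lra |]. field_simplify; lra. }
  assert (0 < s21 t /\ 0 < s13 t /\ 0 < s32 t) as (S1 & S2 & S3).
  { split_and; apply Rinv_0_lt_compat, pow_lt; assumption. }
  assert (B1 : 0 < m1 / (m1 + m2)) by (apply Rdiv_lt_0_compat; lra).
  assert (B2 : 0 < m2 / (m1 + m2)) by (apply Rdiv_lt_0_compat; lra).
  assert (dx : forall p q a b, is_derive p t a -> is_derive q t b ->
    is_derive (fun s => p s - q s) t (a - b)).
  { intros p q a b Hp Hq. exact (is_derive_minus _ _ _ _ _ Hp Hq). }
  assert (dk : forall p a, is_derive p t a -> is_derive (fun s => k * p s) t (k * a)).
  { intros p a Hp. exact (is_derive_scal _ _ _ _ Hp). }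
  assert (acc1 : forall p1 p2 p3, m1 * p1 + m2 * p2 + m3 * p3 = 0 ->
    m3 * ((p3 - p2) / r32 t ^ 3) - m1 * ((p2 - p1) / r21 t ^ 3)
    - (m2 * ((p2 - p1) / r21 t ^ 3) - m3 * ((p1 - p3) / r13 t ^ 3)) =
    - (((m1 + m2) * s21 t + m3 * (m1 / (m1 + m2) * s32 t + m2 / (m1 + m2) * s13 t)) * (p2 - p1)
       + m3 * al * (s13 t - s32 t) / k * (k * p3))).
  { intros p1 p2 p3 Hp; destruct (jacobi p1 p2 p3 Hp) as [-> ->].
    unfold Rdiv at 1 2 3 4 5; fold (s21 t) (s13 t) (s32 t). field; lra. }
  assert (acc2 : forall p1 p2 p3, m1 * p1 + m2 * p2 + m3 * p3 = 0 ->
    k * (m1 * ((p1 - p3) / r13 t ^ 3) - m2 * ((p3 - p2) / r32 t ^ 3)) =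
    - (m3 * al * (s13 t - s32 t) / k * (p2 - p1)
       + al * (m1 * s13 t + m2 * s32 t) * (k * p3))).
  { intros p1 p2 p3 Hp; destruct (jacobi p1 p2 p3 Hp) as [-> ->].
    unfold Rdiv at 1 3; fold (s13 t) (s32 t).
    (* Multiplying by [k] leaves only k^2 = [mu]. This value of k^2 makes the two off-diagonal
       entries of W equal. *)
    apply Rmult_eq_reg_l with k; [| lra].
    replace (k * - (m3 * al * (s13 t - s32 t) / k * (p2 - p1)
       + al * (m1 * s13 t + m2 * s32 t) * (k * p3)))
      with (- (m3 * al * (s13 t - s32 t) * (p2 - p1)
       + (k * k) * al * (m1 * s13 t + m2 * s32 t) * p3)) by (field; lra).
    rewrite <- Rmult_assoc, Hkk. unfold mu, al. field; lra. }
  split; [| split; [| split; [split_and |]]]; cbv beta.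
  + split_and; auto.
  + cbv beta; rewrite <- !acc1, <- !acc2 by assumption. split_and; auto.
  + apply Rplus_le_le_0_compat; [| apply Rmult_le_pos; [lra | apply Rplus_le_le_0_compat]];
      apply Rmult_le_pos; lra.
  + apply Rmult_le_pos; [lra |]. apply Rplus_le_le_0_compat; apply Rmult_le_pos; lra.
  (* The [s21] term of the first diagonal entry only increases det W; without it the determinant is
     m3 al (m1 + m2) s13 s32. *)
  + apply Rle_trans with
      ((m3 * (m1 / (m1 + m2) * s32 t + m2 / (m1 + m2) * s13 t)) * (al * (m1 * s13 t + m2 * s32 t))).
    * replace (m3 * al * (s13 t - s32 t) / k * (m3 * al * (s13 t - s32 t) / k))
        with ((m3 * al * (s13 t - s32 t)) ^ 2 / (k * k)) by (field; lra).
      rewrite Hkk.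
      apply Rminus_le_0.
      replace (_ - _) with (m3 * al * (m1 + m2) * (s13 t * s32 t)).
      -- apply Rmult_le_pos; apply Rmult_le_pos; try lra; apply Rmult_le_pos; lra.
      -- unfold mu, al; field; lra.
    * apply Rmult_le_compat_r.
      -- apply Rmult_le_pos; [lra |]. apply Rplus_le_le_0_compat; apply Rmult_le_pos; lra.
      -- assert (0 <= (m1 + m2) * s21 t) by (apply Rmult_le_pos; lra). lra.
  + assert (I : sigma <= / r21 t + / r13 t + / r32 t).
    { apply Rmult_le_reg_l with (m1 * m2 + m1 * m3 + m2 * m3); [lra |].
      replace ((m1 * m2 + m1 * m3 + m2 * m3) * sigma) with (- E 0) by (unfold sigma; field; lra).
      rewrite <- (EC t) by lra. unfold E.
      pose proof (Rinv_0_lt_compat _ R1); pose proof (Rinv_0_lt_compat _ R2); pose proof (Rinv_0_lt_compat _ R3).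
      assert (0 <= m1 * (u1 t ^ 2 + w1 t ^ 2)) by (apply Rmult_le_pos; [lra | nra]).
      assert (0 <= m2 * (u2 t ^ 2 + w2 t ^ 2)) by (apply Rmult_le_pos; [lra | nra]).
      assert (0 <= m3 * (u3 t ^ 2 + w3 t ^ 2)) by (apply Rmult_le_pos; [lra | nra]).
      nra. }
    assert (C : 3 / 32 * sigma ^ 3 <= s21 t + s13 t + s32 t).
    { unfold s21, s13, s32; rewrite <- !pow_inv.
      apply sum_cubes_lower_bound; try assumption; apply Rlt_le, Rinv_0_lt_compat; assumption. }
    apply Rle_trans with (Rmin m1 m2 * (s21 t + s13 t + s32 t)).
    { apply Rmult_le_compat_l; [lra | assumption]. }
    pose proof (Rmin_l m1 m2); pose proof (Rmin_r m1 m2).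
    assert (Rmin m1 m2 * s21 t <= (m1 + m2) * s21 t) by (apply Rmult_le_compat_r; lra).
    assert (Rmin m1 m2 * s13 t <= m1 * s13 t) by (apply Rmult_le_compat_r; lra).
    assert (Rmin m1 m2 * s32 t <= m2 * s32 t) by (apply Rmult_le_compat_r; lra).
    assert (0 <= m3 * (m1 / (m1 + m2) * s32 t + m2 / (m1 + m2) * s13 t)).
    { apply Rmult_le_pos; [lra | apply Rplus_le_le_0_compat; apply Rmult_le_pos; lra]. }
    assert (0 <= m1 * s13 t) by (apply Rmult_le_pos; lra).
    assert (0 <= m2 * s32 t) by (apply Rmult_le_pos; lra).
    assert (m1 * s13 t + m2 * s32 t <= al * (m1 * s13 t + m2 * s32 t)) by nra.
    lra.
  + apply Rmult_eq_reg_l with (m1 * m2); [| lra].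
    rewrite Rmult_0_r.
    (* This is the angular momentum in Jacobi coordinates, cleared of its denominator m1 + m2. *)
    transitivity ((m1 + m2) * J t); [| rewrite JC; lra].
    transitivity (m1 * m2 * ((x2 t - x1 t) * (w2 t - w1 t) - (y2 t - y1 t) * (u2 t - u1 t))
      + m1 * m2 * (k * k) * (x3 t * w3 t - y3 t * u3 t)); [ring |].
    rewrite Hkk. unfold mu, J.
    assert (bary : forall p1 p2 p3, m1 * p1 + m2 * p2 + m3 * p3 = 0 -> p3 = - (m1 * p1 + m2 * p2) / m3).
    { intros p1 p2 p3 Hp. apply Rmult_eq_reg_l with m3; [| lra]. field_simplify; lra. }
    rewrite (bary _ _ _ CX), (bary _ _ _ CY), (bary _ _ _ CU), (bary _ _ _ CW).
    field; lra.
- intros t Ht.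
  replace ((u2 t - u1 t) * (k * w3 t) - (w2 t - w1 t) * (k * u3 t))
    with (k * ((u2 t - u1 t) * w3 t - (w2 t - w1 t) * u3 t)) by ring.
  apply Rmult_integral_contrapositive; split; [lra | apply Hdet, Ht].
Qed.

(** * Return to complex curves *)

(** From (m1 + m2) v1 = - m2 (v2 - v1) - m3 v3, a direction common to v2 - v1 and v3 carries all
    three velocities on a line through the origin. The case split selects a non-zero direction; if
    both vectors vanish, so do all velocities and any direction serves. *)
Lemma collinear_of_parallel (m1 m2 m3 : R) (v1 v2 v3 : C) :
  0 < m1 -> 0 < m2 ->
  (RtoC m1 * v1 + RtoC m2 * v2 + RtoC m3 * v3 = RtoC 0)%C ->
  (Re v2 - Re v1) * Im v3 - (Im v2 - Im v1) * Re v3 = 0 ->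
  collinear v1 v2 v3.
Proof.
intros M1 M2 Hcm Hpar.
destruct v1 as [a1 b1], v2 as [a2 b2], v3 as [a3 b3]; simpl in Hpar.
injection Hcm as HA HB.
assert (HA' : m1 * a1 + m2 * a2 + m3 * a3 = 0) by lra.
assert (HB' : m1 * b1 + m2 * b2 + m3 * b3 = 0) by lra.
clear HA HB.
assert (main : forall d1 d2 r s : R, (d1, d2) <> RtoC 0 ->
  a2 - a1 = r * d1 -> b2 - b1 = r * d2 -> a3 = s * d1 -> b3 = s * d2 ->
  collinear (a1, b1) (a2, b2) (a3, b3)).
{ intros d1 d2 r s Hd A2 B2 A3 B3.
  exists (RtoC 0), (d1, d2); split; [assumption |].
  exists (- (m3 * s + m2 * r) / (m1 + m2)), ((m1 * r - m3 * s) / (m1 + m2)), s.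
  replace a2 with (a1 + r * d1) in * by lra.
  replace b2 with (b1 + r * d2) in * by lra.
  subst a3 b3.
  assert (A1 : a1 = - (m3 * s + m2 * r) / (m1 + m2) * d1).
  { apply Rmult_eq_reg_l with (m1 + m2); [| lra]. field_simplify; lra. }
  assert (B1 : b1 = - (m3 * s + m2 * r) / (m1 + m2) * d2).
  { apply Rmult_eq_reg_l with (m1 + m2); [| lra]. field_simplify; lra. }
  rewrite A1, B1.
  split_and; apply injective_projections; simpl; field; lra. }
destruct (Req_dec a3 0) as [A3 | A3].
- destruct (Req_dec b3 0) as [B3 | B3].
  + destruct (Req_dec (a2 - a1) 0) as [A | A].
    * destruct (Req_dec (b2 - b1) 0) as [B | B].
      -- apply (main 1 0 0 0); try lra. intros H; injection H; lra.
      -- apply (main (a2 - a1) (b2 - b1) 1 0); try lra. intros H; injection H; lra.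
    * apply (main (a2 - a1) (b2 - b1) 1 0); try lra. intros H; injection H; lra.
  + apply (main a3 b3 ((b2 - b1) / b3) 1); try lra.
    * intros H; injection H; lra.
    * apply Rmult_eq_reg_r with b3; [| assumption]. field_simplify; lra.
    * field; assumption.
- apply (main a3 b3 ((a2 - a1) / a3) 1); try lra.
  + intros H; injection H; lra.
  + field; assumption.
  + apply Rmult_eq_reg_r with a3; [| assumption]. field_simplify; lra.
Qed.

Lemma list_upper_bound (l : list R) : exists T, 0 <= T /\ forall t, In t l -> t < T.
Proof.
induction l as [| a l [T [HT IH]]].
- exists 0; split; [lra | intros t []].
- exists (Rmax T (a + 1)); split; [apply Rle_trans with (1 := HT), Rmax_l |].
  intros t [<- | Ht].
  + apply Rlt_le_trans with (a + 1); [lra | apply Rmax_r].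
  + apply Rlt_le_trans with (1 := IH t Ht), Rmax_l.
Qed.

Lemma inv_square_components (w : C) :
  w <> RtoC 0 ->
  inv_square w = (Re w / Cmod w ^ 3, Im w / Cmod w ^ 3).
Proof.
intros Hw. apply Cmod_gt_0 in Hw.
unfold inv_square, Cdiv. rewrite <- RtoC_inv by (pose proof (pow_lt _ 3 Hw); lra).
apply injective_projections; simpl; unfold Rdiv, Re, Im; ring.
Qed.

Lemma Cmod_sqr (a b : R) : Cmod (a, b) ^ 2 = a ^ 2 + b ^ 2.
Proof. unfold Cmod; simpl fst; simpl snd. apply pow2_sqrt; nra. Qed.

Lemma Cmod_sub (a b c d : R) :
  Cmod ((a, b) - (c, d))%C = sqrt ((a - c) ^ 2 + (b - d) ^ 2).
Proof. reflexivity. Qed.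

Lemma Re_comb (a b : R) (z w : C) : Re (RtoC a * z - RtoC b * w)%C = a * Re z - b * Re w.
Proof. unfold Re, Im; simpl; ring. Qed.

Lemma Im_comb (a b : R) (z w : C) : Im (RtoC a * z - RtoC b * w)%C = a * Im z - b * Im w.
Proof. unfold Re, Im; simpl; ring. Qed.

Theorem theorem1p1 :
  forall (m1 m2 m3 : R) (z1 z2 z3 v1 v2 v3 : R -> C),
    0 < m1 -> 0 < m2 -> 0 < m3 ->
    three_body_solution m1 m2 m3 z1 z2 z3 v1 v2 v3 ->
    collision_free z1 z2 z3 ->
    center_of_mass_at_origin m1 m2 m3 z1 z2 z3 v1 v2 v3 ->
    angular_momentum m1 m2 m3
      (z1 0) (z2 0) (z3 0) (v1 0) (v2 0) (v3 0) = 0 ->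
    energy m1 m2 m3 (z1 0) (z2 0) (z3 0) (v1 0) (v2 0) (v3 0) < 0 ->
    infinitely_many (fun t : R => 0 <= t /\ collinear (v1 t) (v2 t) (v3 t)).
Proof.
intros m1 m2 m3 z1 z2 z3 v1 v2 v3 M1 M2 M3 Hsol Hcol Hcm HJ HE [l Hl].
(* If [l] lists all syzygy times, there is none from [T] on. *)
destruct (list_upper_bound l) as [T [HT HlT]].
destruct (half_line_extension z1 v1) as (x1 & y1 & Z1); [intros t Ht; apply (Hsol t Ht) |].
destruct (half_line_extension z2 v2) as (x2 & y2 & Z2); [intros t Ht; apply (Hsol t Ht) |].
destruct (half_line_extension z3 v3) as (x3 & y3 & Z3); [intros t Ht; apply (Hsol t Ht) |].
destruct (half_line_extension v1 _ (fun t Ht => proj1 (proj2 (Hsol t Ht)))) as (u1 & w1 & V1).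
destruct (half_line_extension v2 _ (fun t Ht => proj1 (proj2 (proj2 (Hsol t Ht))))) as (u2 & w2 & V2).
destruct (half_line_extension v3 _ (fun t Ht => proj2 (proj2 (proj2 (Hsol t Ht))))) as (u3 & w3 & V3).
assert (CE : forall t, 0 <= t ->
  z1 t = (x1 t, y1 t) /\ z2 t = (x2 t, y2 t) /\ z3 t = (x3 t, y3 t) /\
  v1 t = (u1 t, w1 t) /\ v2 t = (u2 t, w2 t) /\ v3 t = (u3 t, w3 t)).
{ intros t Ht.
  destruct (Z1 t Ht) as [[-> _] [-> _]], (Z2 t Ht) as [[-> _] [-> _]], (Z3 t Ht) as [[-> _] [-> _]],
    (V1 t Ht) as [[-> _] [-> _]], (V2 t Ht) as [[-> _] [-> _]], (V3 t Ht) as [[-> _] [-> _]].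
  split_and; apply surjective_pairing. }
apply (planar_three_body_velocity_degenerate m1 m2 m3 x1 x2 x3 y1 y2 y3 u1 u2 u3 w1 w2 w3 T);
  try assumption.
- intros t Ht.
  destruct (Z1 t Ht) as [[_ X1] [_ Y1]], (Z2 t Ht) as [[_ X2] [_ Y2]], (Z3 t Ht) as [[_ X3] [_ Y3]],
    (V1 t Ht) as [[_ U1] [_ W1]], (V2 t Ht) as [[_ U2] [_ W2]], (V3 t Ht) as [[_ U3] [_ W3]].
  destruct (Hcol t Ht) as (C12 & C23 & C13).
  destruct (Hcm t Ht) as (CZ & CV).
  assert (N21 : (z2 t - z1 t)%C <> RtoC 0) by (intros H; apply C12; symmetry; now apply Ceq_minus).
  assert (N13 : (z1 t - z3 t)%C <> RtoC 0) by (intros H; apply C13; now apply Ceq_minus).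
  assert (N32 : (z3 t - z2 t)%C <> RtoC 0) by (intros H; apply C23; symmetry; now apply Ceq_minus).
  rewrite !inv_square_components in U1, U2, U3, W1, W2, W3 by assumption.
  apply Cmod_gt_0 in N21, N13, N32.
  destruct (CE t Ht) as (E1 & E2 & E3 & F1 & F2 & F3).
  rewrite E1, E2, E3 in *; rewrite F1, F2, F3 in *.
  split; [split_and; assumption |].
  split.
  + rewrite !Re_comb, !Im_comb in *.
    split_and; assumption.
  + split; [split_and; assumption |].
    injection CZ as CZ1 CZ2; injection CV as CV1 CV2.
    split_and; lra.
- refine (eq_trans _ HJ).
  destruct (CE 0 (Rle_refl 0)) as (-> & -> & -> & -> & -> & ->).
  reflexivity.
- refine (Rle_lt_trans _ _ _ (Req_le _ _ _) HE).
  destruct (CE 0 (Rle_refl 0)) as (-> & -> & -> & -> & -> & ->).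
  unfold energy. rewrite !Cmod_sqr.
  rewrite (Cmod_sub (x1 0) (y1 0)), (Cmod_sub (x1 0) (y1 0)), (Cmod_sub (x2 0) (y2 0)).
  unfold Rdiv.
  (* [energy] uses z1 - z2 and z2 - z3, whereas [r21] and [r32] use the opposite vectors. *)
  replace ((x2 0 - x1 0) ^ 2 + (y2 0 - y1 0) ^ 2)
    with ((x1 0 - x2 0) ^ 2 + (y1 0 - y2 0) ^ 2) by ring.
  replace ((x3 0 - x2 0) ^ 2 + (y3 0 - y2 0) ^ 2)
    with ((x2 0 - x3 0) ^ 2 + (y2 0 - y3 0) ^ 2) by ring.
  reflexivity.
- intros t Ht Hpar.
  assert (Ht0 : 0 <= t) by lra.
  assert (Hin : In t l).
  { apply Hl; split; [assumption |].
    apply (collinear_of_parallel m1 m2 m3); [assumption | assumption | apply (Hcm t Ht0) |].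
    destruct (CE t Ht0) as (_ & _ & _ & -> & -> & ->). exact Hpar. }
  specialize (HlT t Hin); lra.
Qed.
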